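(* Let $0<M<1$. If $f\in S_M$, then $\mathcal{B}_c(f)\in S_M$ for each $c=0,1,2,3,\dots$. Hence $\mathcal{B}_c(S_M)\subset S_M$.
   Context: $\mathbb{D}$ is the open unit disk in $\mathbb{C}$, $\mathcal{H}(\mathbb{D})$ is the class of functions analytic in $\mathbb{D}$, and $\mathcal{H}_0(\mathbb{D})$ is the set of $f\in\mathcal{H}(\mathbb{D})$ with $f(0)=0$ and $f'(0)=1$. For $0<M<1$, $$S_M=\left\{f\in\mathcal{H}_0(\mathbb{D}):\ \left|\frac{zf'(z)}{f(z)}-1\right|<M \text{ for all } z\in\mathbb{D}\right\},$$ where $zf'(z)/f(z)$ is understood to be analytic in $\mathbb{D}$ (with value $1$ at $z=0$; in particular $f\neq 0$ on $\mathbb{D}\setminus\{0\}$). The Bernardi transform of $f\in\mathcal{H}_0(\mathbb{D})$ is $$\mathcal{B}_c(f)(z)=\frac{1+c}{z^c}\int_0^z \zeta^{c-1}f(\zeta)\,d\zeta,$$ extended analytically to $z=0$ with value $0$. *)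

(* Defs.v *)
From Stdlib Require Import Reals.
From Coquelicot Require Import Coquelicot.

Local Open Scope C_scope.

(** Functions on the open unit disk are represented by total functions
    [C -> C]; only their values on the disk are relevant. *)

Definition unit_disk (z : C) : Prop := (Cmod z < 1)%R.

(** [ex_derive] at type [C -> C] is complex differentiability. *)
Definition analytic_in_disk (f : C -> C) : Prop :=
  forall z : C, unit_disk z -> ex_derive f z.

Definition normalized (f : C -> C) : Prop :=
  analytic_in_disk f /\ f 0 = 0 /\ C_derive f 0 = 1.

(** The quotient [z f'(z) / f(z)] with its removable singularity at [0]
    filled in by the value [1]. *)
Definition log_quotient (f : C -> C) (z : C) : C :=
  if Ceq_dec z 0 then 1 else z * C_derive f z / f z.

(** Division is total on [C], so the absence of zeros off the origin has to be
    stated next to the analyticity of the quotient. *)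
Definition S_class (M : R) (f : C -> C) : Prop :=
  normalized f /\
  (forall z : C, unit_disk z -> z <> 0 -> f z <> 0) /\
  analytic_in_disk (log_quotient f) /\
  (forall z : C, unit_disk z -> (Cmod (log_quotient f z - 1) < M)%R).

(** Integral of [g] along the segment from [0] to [z], parametrized by
    [t |-> t z] for [t] in [[0, 1]]. *)
Definition segment_integral (g : C -> C) (z : C) : C :=
  z * RInt (V := C_R_CompleteNormedModule) (fun t : R => g (RtoC t * z)) 0 1.

(** [z ^ (c - 1)], an exponent that is [-1] when [c = 0]. *)
Definition Cpow_pred (z : C) (c : nat) : C :=
  match c with
  | O => / z
  | S k => z ^ k
  end.

(** For [c = 0] the integrand [f zeta / zeta] has a removable singularity at
    the endpoint [zeta = 0]; its value at that single point does not affect the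
    integral. *)
Definition bernardi (c : nat) (f : C -> C) (z : C) : C :=
  if Ceq_dec z 0 then 0
  else (1 + RtoC (INR c)) / z ^ c *
       segment_integral (fun zeta : C => Cpow_pred zeta c * f zeta) z.

(** The image of a class [A] of functions under the transform, functions being
    identified when they agree on the disk. *)
Definition bernardi_image (c : nat) (A : (C -> C) -> Prop) (g : C -> C) : Prop :=
  exists f : C -> C, A f /\ (forall z : C, unit_disk z -> g z = bernardi c f z).

(* Main.v *)
(** Writing [f = z h] and [q = z f'/f], one has [h' = h (q - 1) / z], which is
    continuous, so the moment [H z = (1 + c) int_0^1 t^c h(t z) dt] may be
    differentiated under the integral sign without Cauchy's theorem.  The
    Bernardi transform is [z H], and integration by parts gives
    [z H' = (1 + c) (h - H)].  With [W = z H'/H] this is the Briot-Bouquet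
    equation [W + z W' / (1 + c + W) = q - 1].  At a point of least modulus
    where [|W| < M] fails, a first-order comparison in the direction
    [- z / (1 + c + W)] yields [|q - 1| >= M], a contradiction. *)

Require Import Defs.
From Stdlib Require Import Reals Lra Lia ClassicalEpsilon Classical.
From Coquelicot Require Import Coquelicot.

Local Open Scope C_scope.

(** Such an estimate is usually drawn from Jack's lemma, hence from the maximum principle. Here only
    complex differentiability and continuous derivatives are at hand; the continuity of [h'] comes
    from the analyticity of [log_quotient f] at [0], which makes [(q - 1) / z] continuous there. The
    direction of comparison is dictated by the equation for [W]: with [k = 1 + c], a point moving
    with velocity [- z / (k + W)] sees [W] change at the rate [W - (q - 1)]. Since [Re (k + W) > 0]
    when [|W| = M < 1], this motion enters the smaller disk, where [|W| < M]. So the rate of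
    [|W|^2], which is [2 (M^2 - Re (conj W (q - 1)))], cannot be positive, and [|q - 1| >= M]. [W]
    itself is avoided until [H] is known not to vanish at the point considered: the condition
    compares [|z H'|] with [M |H|]. The function [z H'] is always handled as [k (h - H)], so that no
    second derivative of [H] is needed. *)

Local Notation is_Cderive := (is_derive (K := C_AbsRing) (V := C_NormedModule)).
Local Notation Ccontinuous := (continuous (T := C_UniformSpace) (U := C_UniformSpace)).
Local Notation is_CRInt := (is_RInt (V := C_R_NormedModule)).

(** * Continuity and complex derivatives *)

Lemma continuous_Cparts {U : UniformSpace} (f : U -> C) (x : U) :
  continuous (fun y => Re (f y)) x -> continuous (fun y => Im (f y)) x ->
  continuous f x.
Proof.
intros Hr Hi P [e He].
pose proof (Hr (ball (Re (f x)) e) (locally_ball _ e)) as Hr'.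
pose proof (Hi (ball (Im (f x)) e) (locally_ball _ e)) as Hi'.
pose proof (filter_and (F := locally x) _ _ Hr' Hi') as H.
revert H; unfold filtermap; apply filter_imp; intros y [H1 H2].
apply He; split; assumption.
Qed.

Lemma continuous_Re {U : UniformSpace} (f : U -> C) (x : U) :
  continuous f x -> continuous (fun y => Re (f y)) x.
Proof.
intros H; apply (continuous_comp f (fun u : C => fst u)); [exact H|].
destruct (f x) as [a b]; apply continuous_fst.
Qed.

Lemma continuous_Im {U : UniformSpace} (f : U -> C) (x : U) :
  continuous f x -> continuous (fun y => Im (f y)) x.
Proof.
intros H; apply (continuous_comp f (fun u : C => snd u)); [exact H|].
destruct (f x) as [a b]; apply continuous_snd.
Qed.

Lemma continuous_Cplus {U : UniformSpace} (f g : U -> C) (x : U) :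
  continuous f x -> continuous g x -> continuous (fun y => f y + g y) x.
Proof.
intros Hf Hg; apply continuous_Cparts.
- apply (continuous_plus (V := R_NormedModule) (fun y => Re (f y)) (fun y => Re (g y)));
    apply continuous_Re; assumption.
- apply (continuous_plus (V := R_NormedModule) (fun y => Im (f y)) (fun y => Im (g y)));
    apply continuous_Im; assumption.
Qed.

Lemma continuous_Copp {U : UniformSpace} (f : U -> C) (x : U) :
  continuous f x -> continuous (fun y => - f y) x.
Proof.
intros Hf; apply continuous_Cparts.
- apply (continuous_opp (V := R_NormedModule) (fun y => Re (f y)));
    apply continuous_Re; assumption.
- apply (continuous_opp (V := R_NormedModule) (fun y => Im (f y)));
    apply continuous_Im; assumption.
Qed.

Lemma continuous_Cminus {U : UniformSpace} (f g : U -> C) (x : U) :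
  continuous f x -> continuous g x -> continuous (fun y => f y - g y) x.
Proof.
intros Hf Hg; apply continuous_Cplus; [exact Hf|apply continuous_Copp; exact Hg].
Qed.

Lemma continuous_Rmult_fct {U : UniformSpace} (f g : U -> R) (x : U) :
  continuous f x -> continuous g x -> continuous (fun y => f y * g y)%R x.
Proof. exact (continuous_mult (K := R_AbsRing) f g x). Qed.

Lemma continuous_Cmult {U : UniformSpace} (f g : U -> C) (x : U) :
  continuous f x -> continuous g x -> continuous (fun y => f y * g y) x.
Proof.
intros Hf Hg.
pose proof (continuous_Re f x Hf) as fr; pose proof (continuous_Im f x Hf) as fi.
pose proof (continuous_Re g x Hg) as gr; pose proof (continuous_Im g x Hg) as gi.
apply continuous_Cparts.
- exact (continuous_minus (V := R_NormedModule) _ _ x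
    (continuous_Rmult_fct _ _ x fr gr) (continuous_Rmult_fct _ _ x fi gi)).
- exact (continuous_plus (V := R_NormedModule) _ _ x
    (continuous_Rmult_fct _ _ x fr gi) (continuous_Rmult_fct _ _ x fi gr)).
Qed.

Lemma Re2_Im2_neq_0 (z : C) : z <> 0 -> (fst z ^ 2 + snd z ^ 2)%R <> 0%R.
Proof.
intros Hz H; apply Hz; destruct z as [a b]; simpl in H.
apply injective_projections; simpl; nra.
Qed.

Lemma continuous_Cinv {U : UniformSpace} (f : U -> C) (x : U) :
  f x <> 0 -> continuous f x -> continuous (fun y => / f y) x.
Proof.
intros H0 Hf.
assert (Hd : continuous (fun y => / (fst (f y) ^ 2 + snd (f y) ^ 2))%R x).
{ apply (continuous_comp (fun y => fst (f y) ^ 2 + snd (f y) ^ 2)%R Rinv);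
    [|now apply continuous_Rinv, Re2_Im2_neq_0].
  apply (continuous_plus (V := R_NormedModule)
    (fun y => (fst (f y) ^ 2)%R) (fun y => (snd (f y) ^ 2)%R)); simpl.
  - apply (continuous_mult (K := R_AbsRing) (fun y => fst (f y))
      (fun y => (fst (f y) * 1)%R)); [now apply (continuous_Re f)|].
    apply (continuous_mult (K := R_AbsRing) (fun y => fst (f y))
      (fun y => 1%R)); [now apply (continuous_Re f)|apply continuous_const].
  - apply (continuous_mult (K := R_AbsRing) (fun y => snd (f y))
      (fun y => (snd (f y) * 1)%R)); [now apply (continuous_Im f)|].
    apply (continuous_mult (K := R_AbsRing) (fun y => snd (f y))
      (fun y => 1%R)); [now apply (continuous_Im f)|apply continuous_const]. }
apply continuous_Cparts.
- apply (continuous_mult (K := R_AbsRing) (fun y => fst (f y)) _ x);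
    [now apply (continuous_Re f)|exact Hd].
- apply (continuous_mult (K := R_AbsRing) (fun y => (- snd (f y))%R) _ x); [|exact Hd].
  apply (continuous_opp (V := R_NormedModule) (fun y => snd (f y))); now apply (continuous_Im f).
Qed.

Lemma continuous_Cdiv {U : UniformSpace} (f g : U -> C) (x : U) :
  g x <> 0 -> continuous f x -> continuous g x -> continuous (fun y => f y / g y) x.
Proof.
intros H0 Hf Hg; apply continuous_Cmult; [exact Hf|now apply continuous_Cinv].
Qed.

(** The uniform structure of [C] is that of a product, with squares as balls; passing between
    squares and round disks costs the factor [sqrt 2]. *)
Lemma locally_Cmod (z : C) (P : C -> Prop) :
  locally (T := C_UniformSpace) z P <->
  exists d : R, (0 < d)%R /\ forall w, (Cmod (w - z) < d)%R -> P w.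
Proof.
split.
- intros [d Hd]; exists d; split; [apply cond_pos|].
  intros w Hw; apply Hd, C_NormedModule_mixin_compat1, Hw.
- intros [d [Hd H]].
  assert (Hs : (0 < sqrt 2)%R) by (apply sqrt_lt_R0; lra).
  assert (He : (0 < d / sqrt 2)%R) by (apply Rdiv_lt_0_compat; assumption).
  exists (mkposreal _ He); intros w Hw; apply H.
  apply C_NormedModule_mixin_compat2 in Hw; simpl in Hw.
  replace d with (sqrt 2 * (d / sqrt 2))%R by (field; lra); exact Hw.
Qed.

Lemma Ccontinuous_Cmod_iff (f : C -> C) (z : C) :
  Ccontinuous f z <->
  forall e : R, (0 < e)%R -> exists d : R, (0 < d)%R /\
    forall w, (Cmod (w - z) < d)%R -> (Cmod (f w - f z) < e)%R.
Proof.
split.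
- intros H e He; apply (locally_Cmod z).
  apply (H (fun u => (Cmod (u - f z) < e)%R)), locally_Cmod.
  exists e; split; [exact He|trivial].
- intros H P HP; apply locally_Cmod in HP; destruct HP as [e [He HP]].
  apply (locally_Cmod z); destruct (H e He) as [d [Hd H']].
  exists d; split; [exact Hd|]; intros w Hw; apply HP, H', Hw.
Qed.

Lemma is_Cderive_Cmod_iff (f : C -> C) (z l : C) :
  is_Cderive f z l <->
  forall e : R, (0 < e)%R -> exists d : R, (0 < d)%R /\
    forall w, (Cmod (w - z) < d)%R ->
      (Cmod (f w - f z - (w - z) * l) <= e * Cmod (w - z))%R.
Proof.
split.
- intros [_ H] e He.
  specialize (H z (fun P HP => HP) (mkposreal e He)).
  apply (locally_C z) in H; apply (locally_Cmod z) in H; exact H.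
- intros H; split; [apply is_linear_scal_l|].
  intros x Hx e.
  apply (is_filter_lim_locally_unique (V := AbsRing_NormedModule C_AbsRing) z x) in Hx.
  rewrite <- Hx.
  apply (locally_C z), (locally_Cmod z); exact (H e (cond_pos e)).
Qed.

Lemma is_Cderive_continuous (f : C -> C) (z l : C) :
  is_Cderive f z l ->
  Ccontinuous f z.
Proof.
intros H.
assert (H' : continuous (T := AbsRing_UniformSpace C_AbsRing) (U := C_NormedModule) f z).
{ apply ex_derive_continuous; exists l; exact H. }
intros P HP; apply locally_C; exact (H' P HP).
Qed.

(** Carathéodory's form of the derivative: [p] is the difference quotient, filled in by [l]. It
    turns the product and inverse rules into algebra, and at the origin it removes the singularities
    of [f z / z] and [(q - 1) / z]. *)
Lemma Cderive_caratheodory (f : C -> C) (z l : C) :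
  is_Cderive f z l ->
  exists p : C -> C,
    Ccontinuous p z /\
    p z = l /\ forall w, f w - f z = (w - z) * p w.
Proof.
intros H; exists (fun w => if Ceq_dec w z then l else (f w - f z) / (w - z)).
  destruct (Ceq_dec z z) as [_|n]; [|congruence].
  split; [|split; [reflexivity|]].
  + apply Ccontinuous_Cmod_iff; intros e He.
    destruct (Ceq_dec z z) as [_|n]; [|congruence].
    assert (He2 : (0 < e / 2)%R) by lra.
    destruct (proj1 (is_Cderive_Cmod_iff f z l) H _ He2) as [d [Hd H']].
    exists d; split; [exact Hd|]; intros w Hw.
    destruct (Ceq_dec w z) as [->|n].
    * replace (l - l) with (RtoC 0) by ring; rewrite Cmod_0; exact He.
    * assert (Hn : w - z <> 0) by now apply Cminus_eq_contra.
      apply Rle_lt_trans with (e / 2)%R; [|lra].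
      apply Rmult_le_reg_r with (Cmod (w - z)); [now apply Cmod_gt_0|].
      rewrite <- Cmod_mult.
      replace (((f w - f z) / (w - z) - l) * (w - z))
        with (f w - f z - (w - z) * l) by (field; exact Hn).
      now apply H'.
  + intros w; destruct (Ceq_dec w z) as [->|n]; [ring|].
    field; now apply Cminus_eq_contra.
Qed.

Lemma is_Cderive_caratheodory (f p : C -> C) (z l : C) :
  Ccontinuous p z -> p z = l ->
  locally (T := C_UniformSpace) z (fun w => f w - f z = (w - z) * p w) ->
  is_Cderive f z l.
Proof.
intros Hp <- Hf; apply is_Cderive_Cmod_iff; intros e He.
apply locally_Cmod in Hf; destruct Hf as [d' [Hd' Hf]].
destruct (proj1 (Ccontinuous_Cmod_iff p z) Hp e He) as [d [Hd H']].
exists (Rmin d d'); split; [now apply Rmin_pos|]; intros w Hw.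
assert (H1 : (Cmod (w - z) < d)%R) by (eapply Rlt_le_trans; [exact Hw|apply Rmin_l]).
assert (H2 : (Cmod (w - z) < d')%R) by (eapply Rlt_le_trans; [exact Hw|apply Rmin_r]).
rewrite (Hf w H2).
replace ((w - z) * p w - (w - z) * p z) with ((p w - p z) * (w - z)) by ring.
rewrite Cmod_mult; apply Rmult_le_compat_r; [apply Cmod_ge_0|].
now apply Rlt_le, H'.
Qed.

Lemma locally_neq_0 (f : C -> C) (z : C) :
  Ccontinuous f z -> f z <> 0 ->
  locally (T := C_UniformSpace) z (fun w => f w <> 0).
Proof.
intros Hf H0; apply Cmod_gt_0 in H0; apply locally_Cmod.
destruct (proj1 (Ccontinuous_Cmod_iff f z) Hf _ H0) as [d [Hd H]].
exists d; split; [exact Hd|]; intros w Hw Ew; specialize (H w Hw).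
rewrite Ew in H; replace (0 - f z) with (- f z) in H by ring.
rewrite Cmod_opp in H; lra.
Qed.


Lemma is_Cderive_mult (f g : C -> C) (z df dg : C) :
  is_Cderive f z df -> is_Cderive g z dg ->
  is_Cderive (fun w => f w * g w) z (df * g z + f z * dg).
Proof.
intros Hf Hg.
pose proof (is_Cderive_continuous g z dg Hg) as Cg.
apply Cderive_caratheodory in Hf; destruct Hf as [p [Hp [Ep Hf]]].
apply Cderive_caratheodory in Hg; destruct Hg as [r [Hr [Er Hg]]].
apply (is_Cderive_caratheodory _ (fun w => p w * g w + f z * r w)).
- apply continuous_Cplus; apply continuous_Cmult; try assumption.
  apply continuous_const.
- now rewrite Ep, Er.
- apply filter_forall; intros w.
  replace (f w * g w - f z * g z) with ((f w - f z) * g w + f z * (g w - g z)) by ring.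
  rewrite Hf, Hg; ring.
Qed.

Lemma is_Cderive_inv (f : C -> C) (z df : C) :
  f z <> 0 -> is_Cderive f z df ->
  is_Cderive (fun w => / f w) z (- df / (f z * f z)).
Proof.
intros H0 Hf.
pose proof (is_Cderive_continuous f z df Hf) as Cf.
apply Cderive_caratheodory in Hf; destruct Hf as [p [Hp [Ep Hf]]].
apply (is_Cderive_caratheodory _ (fun w => - p w / (f w * f z))).
- apply continuous_Cdiv; [now apply Cmult_neq_0|now apply continuous_Copp|].
  apply continuous_Cmult; [exact Cf|apply continuous_const].
- now rewrite Ep.
- generalize (locally_neq_0 f z Cf H0); apply filter_imp; intros w Hw.
  replace (/ f w - / f z) with (- (f w - f z) / (f w * f z)) by (field; auto).
  rewrite Hf; field; auto.
Qed.

(** * Restriction to real segments and the mean value inequality *)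

Lemma continuous_RtoC (t : R) : continuous (U := C_UniformSpace) RtoC t.
Proof.
apply continuous_Cparts; [apply continuous_id|apply continuous_const].
Qed.

Lemma continuous_Cpath (g : C -> C) (a v : C) (t : R) :
  Ccontinuous g (a + t * v) ->
  continuous (U := C_UniformSpace) (fun s : R => g (a + RtoC s * v)) t.
Proof.
intros Hg; apply (continuous_comp (V := C_UniformSpace) (fun s : R => a + s * v) g); [|exact Hg].
apply continuous_Cplus; [apply continuous_const|].
apply continuous_Cmult; [apply continuous_RtoC|apply continuous_const].
Qed.

(** An abstract real-linear [p] of norm at most one lets [Re] and [Im] share a single estimate. *)
Lemma is_derive_path (p : C -> R) (g : C -> C) (a v l : C) (t : R) :
  (forall x y : C, p (x - y) = (p x - p y)%R) ->
  (forall (r : R) (x : C), p (r * x) = (r * p x)%R) ->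
  (forall x : C, Rabs (p x) <= Cmod x)%R ->
  is_Cderive g (a + t * v) l ->
  is_derive (fun s : R => p (g (a + RtoC s * v))) t (p (v * l)).
Proof.
intros pB pZ p1 Hg; split; [apply is_linear_scal_l|].
intros x Hx e.
apply (is_filter_lim_locally_unique (V := R_NormedModule) t x) in Hx; rewrite <- Hx.
(* Dividing by [Cmod v + 1] rather than by [Cmod v] covers [v = 0]. *)
assert (Hv : (0 < Cmod v + 1)%R) by (generalize (Cmod_ge_0 v); lra).
assert (He : (0 < e / (Cmod v + 1))%R) by (apply Rdiv_lt_0_compat; [apply cond_pos|exact Hv]).
destruct (proj1 (is_Cderive_Cmod_iff _ _ _) Hg _ He) as [d [Hd H]].
assert (Hd' : (0 < d / (Cmod v + 1))%R) by (apply Rdiv_lt_0_compat; assumption).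
exists (mkposreal _ Hd'); intros s Hs.
change (Rabs (s - t) < d / (Cmod v + 1))%R in Hs.
change (Rabs (p (g (a + RtoC s * v)%C) - p (g (a + t * v)%C) - (s - t) * p (v * l)%C) <= e * Rabs (s - t))%R.
rewrite <- pZ, <- !pB.
eapply Rle_trans; [apply p1|].
assert (E : Cmod (a + s * v - (a + t * v)) = (Rabs (s - t) * Cmod v)%R).
{ replace (a + s * v - (a + t * v)) with (RtoC (s - t) * v) by (rewrite RtoC_minus; ring).
  now rewrite Cmod_mult, Cmod_R. }
specialize (H (a + RtoC s * v)); rewrite E in H.
replace ((s - t)%R * (v * l)) with ((a + s * v - (a + t * v)) * l)
  by (rewrite RtoC_minus; ring).
assert (Hq : (d / (Cmod v + 1) * (Cmod v + 1) = d)%R) by (field; lra).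
assert (Hq' : (e / (Cmod v + 1) * (Cmod v + 1) = e)%R) by (field; lra).
generalize (Rabs_pos (s - t)) (Cmod_ge_0 v); intros A B.
eapply Rle_trans; [apply H; nra|].
rewrite <- Hq' at 2; apply Rlt_le in He;
rewrite Rmult_assoc; apply Rmult_le_compat_l; [exact He|]; nra.
Qed.

Lemma Rabs_Im_le_Cmod (z : C) : (Rabs (Im z) <= Cmod z)%R.
Proof. eapply Rle_trans; [apply Rmax_r|apply Rmax_Cmod]. Qed.

Lemma is_derive_Re_path (g : C -> C) (a v l : C) (t : R) :
  is_Cderive g (a + t * v) l ->
  is_derive (fun s : R => Re (g (a + RtoC s * v))) t (Re (v * l)).
Proof.
apply is_derive_path.
- intros x y; reflexivity.
- apply re_scal_l.
- apply re_le_Cmod.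
Qed.

Lemma is_derive_Im_path (g : C -> C) (a v l : C) (t : R) :
  is_Cderive g (a + t * v) l ->
  is_derive (fun s : R => Im (g (a + RtoC s * v))) t (Im (v * l)).
Proof.
apply is_derive_path.
- intros x y; reflexivity.
- apply im_scal_l.
- apply Rabs_Im_le_Cmod.
Qed.

Lemma is_Cderive_id (z : C) : is_Cderive (fun w => w) z (RtoC 1).
Proof.
apply is_Cderive_Cmod_iff; intros e He; exists 1%R; split; [lra|]; intros w _.
replace (w - z - (w - z) * 1) with (RtoC 0) by ring.
rewrite Cmod_0; apply Rmult_le_pos; [lra|apply Cmod_ge_0].
Qed.

Lemma is_Cderive_const (a z : C) : is_Cderive (fun _ => a) z (RtoC 0).
Proof. exact (is_derive_const (K := C_AbsRing) (V := C_NormedModule) a z). Qed.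

Lemma is_Cderive_minus (f g : C -> C) (z df dg : C) :
  is_Cderive f z df -> is_Cderive g z dg ->
  is_Cderive (fun w => f w - g w) z (df - dg).
Proof. exact (is_derive_minus (K := C_AbsRing) (V := C_NormedModule) f g z df dg). Qed.

(* The vector-valued inequality follows from the real mean value theorem applied
   to the component of the increment in its own direction. *)
Lemma mean_value_C (g dg : C -> C) (a k L : C) (e : R) :
  (forall s : R, (0 < s < 1)%R -> is_Cderive g (a + s * k) (dg (a + s * k))) ->
  (forall s : R, (0 <= s <= 1)%R -> Ccontinuous g (a + s * k)) ->
  (forall s : R, (0 <= s <= 1)%R -> (Cmod (dg (a + s * k)%C - L) <= e)%R) ->
  (Cmod (g (a + k)%C - g a - k * L) <= e * Cmod k)%R.
Proof.
intros Hd Hc He.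
set (v := g (a + k) - g a - k * L).
set (g1 := fun w : C => Cconj v * (g w - w * L)).
destruct (MVT_gen (fun s : R => Re (g1 (a + s * k)%C)) 0 1
  (fun s => Re (k * (Cconj v * (dg (a + RtoC s * k)%C - L)))%C)) as [s [Hs E]].
- rewrite Rmin_left, Rmax_right by lra; intros s Hs.
  apply is_derive_Re_path; unfold g1.
  replace (Cconj v * (dg (a + s * k) - L))
    with (0 * (g (a + s * k) - (a + s * k) * L)
      + Cconj v * (dg (a + s * k) - (1 * L + (a + s * k) * 0))) by ring.
  apply (is_Cderive_mult (fun _ => Cconj v) (fun w => g w - w * L)); [apply is_Cderive_const|].
  apply is_Cderive_minus; [now apply Hd|].
  apply (is_Cderive_mult (fun w => w) (fun _ => L)); [apply is_Cderive_id|apply is_Cderive_const].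
- rewrite Rmin_left, Rmax_right by lra; intros s Hs.
  apply continuity_pt_filterlim.
  apply (continuous_Re (fun s : R => g1 (a + s * k))).
  apply continuous_Cpath; unfold g1.
  apply continuous_Cmult; [apply continuous_const|].
  apply continuous_Cminus; [now apply Hc|].
  apply continuous_Cmult; [apply continuous_id|apply continuous_const].
- rewrite Rmin_left, Rmax_right in Hs by lra.
  (* The total increase of [Re g1] is [Re (conj v * v)], so the mean value identity gives
     [|v|^2 <= |k| |v| e], and one factor [|v|] cancels. *)
  assert (E2 : (Re (g1 (a + 1%R * k)%C) - Re (g1 (a + 0%R * k)%C) = Cmod v ^ 2)%R).
  { replace (a + 1%R * k) with (a + k) by ring.
    replace (a + 0%R * k) with a by ring.
    apply RtoC_inj; rewrite Cmod2_conj.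
    transitivity (RtoC (Re (g1 (a + k) - g1 a))).
    { f_equal. }
    replace (g1 (a + k) - g1 a) with (v * Cconj v) by (unfold g1, v; ring).
    rewrite <- Cmod2_conj; now rewrite re_RtoC. }
  rewrite E2 in E.
  assert (B : (Re (k * (Cconj v * (dg (a + s * k)%C - L)))%C <= Cmod k * (Cmod v * e))%R).
  { eapply Rle_trans; [eapply Rle_trans; [apply Rle_abs|apply re_le_Cmod]|].
    rewrite !Cmod_mult, Cmod_conj.
    apply Rmult_le_compat_l; [apply Cmod_ge_0|].
    apply Rmult_le_compat_l; [apply Cmod_ge_0|now apply He]. }
  generalize (Cmod_ge_0 k) (Cmod_ge_0 v); intros K V.
  assert (0 <= e)%R by (eapply Rle_trans; [apply Cmod_ge_0|apply (He s Hs)]).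
  destruct (Req_dec (Cmod v) 0) as [Z|Z]; [rewrite Z; nra|].
  apply Rmult_le_reg_l with (Cmod v); [lra|]; nra.
Qed.

(** * Compactness of closed disks *)

(** One Lebesgue number statement, with [Q u d] meaning that radius [d] is good at [u], serves both
    uniform continuity and the extension step of [first_failure_disk]. *)
Lemma lebesgue_number_disk (r : R) (Q : C -> R -> Prop) :
  (forall u, (Cmod u <= r)%R -> exists d : R, (0 < d)%R /\ Q u d) ->
  exists d : R, (0 < d)%R /\ forall z, (Cmod z <= r)%R ->
    exists (u : C) (e : R),
      (Cmod u <= r)%R /\ Q u e /\ (Cmod (z - u) < e)%R /\ (d <= e)%R.
Proof.
intros H.
(* The compactness theorem wants a gauge on the whole square. At a centre outside the disk, half the
   distance to the disk is taken, so that such a centre never captures a point of the disk. The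
   factor 2 absorbs the [sqrt 2] between coordinatewise closeness and [Cmod]. *)
assert (Hdel : forall x y : R, exists d : posreal,
  (Cmod (x, y) <= r -> Q (x, y) (2 * d))%R /\
  (r < Cmod (x, y) -> 2 * d <= Cmod (x, y) - r)%R).
{ intros x y; destruct (Rle_lt_dec (Cmod (x, y)) r) as [L|L].
  - destruct (H _ L) as [d [Hd Hq]].
    assert (Hd2 : (0 < d / 2)%R) by lra.
    exists (mkposreal _ Hd2); simpl; split; [|lra].
    intros _; now replace (2 * (d / 2))%R with d by field.
  - assert (Hd2 : (0 < (Cmod (x, y) - r) / 2)%R) by lra.
    exists (mkposreal _ Hd2); simpl; split; lra. }
set (delta := fun x y => proj1_sig (constructive_indefinite_description _ (Hdel x y))).
destruct (compactness_value_2d (- r) r (- r) r delta) as [d Hd].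
exists (2 * d)%R; split; [generalize (cond_pos d); lra|]; intros [x y] Hz.
assert (Hx : (- r <= x <= r)%R).
{ apply Rabs_le_between; eapply Rle_trans; [apply (re_le_Cmod (x, y))|exact Hz]. }
assert (Hy : (- r <= y <= r)%R).
{ apply Rabs_le_between; eapply Rle_trans; [apply (Rabs_Im_le_Cmod (x, y))|exact Hz]. }
apply NNPP; intros N; apply (Hd x y Hx Hy); intros [u [v [Hu [Hv [H1 [H2 H3]]]]]]; apply N.
revert H1 H2 H3; unfold delta.
destruct (constructive_indefinite_description _ (Hdel u v)) as [q [Hq1 Hq2]]; simpl; intros H1 H2 H3.
assert (Hm : (Cmod ((x, y) - (u, v)) < 2 * q)%R).
{ eapply Rle_lt_trans; [apply Cmod_2Rmax|]; simpl.
  assert (Hmax : (Rmax (Rabs (x + - u)) (Rabs (y + - v)) < q)%R) by now apply Rmax_lub_lt.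
  assert (Hs : (sqrt 2 < 2)%R).
  { rewrite <- (sqrt_square 2) at 2 by lra; apply sqrt_lt_1; lra. }
  assert (Hs0 : (0 <= sqrt 2)%R) by apply sqrt_pos.
  assert (0 <= Rmax (Rabs (x + - u)) (Rabs (y + - v)))%R
    by (eapply Rle_trans; [apply Rabs_pos|apply Rmax_l]).
  nra. }
destruct (Rle_lt_dec (Cmod (u, v)) r) as [L|L].
- exists (u, v), (2 * q)%R; repeat split; auto; lra.
- exfalso; specialize (Hq2 L).
  assert (T : (Cmod (u, v) <= Cmod (x, y) + Cmod ((x, y) - (u, v)))%R).
  { replace (u, v) with ((x, y) + - ((x, y) - (u, v))) at 1 by ring.
    eapply Rle_trans; [apply Cmod_triangle|]; rewrite Cmod_opp; lra. }
  lra.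
Qed.

(** Only [z] is confined to the closed disk: in [is_Cderive_moment] the neighbouring points may have
    larger modulus. *)
Lemma uniform_continuity_disk (g : C -> C) (r : R) :
  (forall u, (Cmod u <= r)%R -> Ccontinuous g u) ->
  forall e : R, (0 < e)%R -> exists d : R, (0 < d)%R /\
    forall z w, (Cmod z <= r)%R -> (Cmod (w - z) < d)%R -> (Cmod (g w - g z) < e)%R.
Proof.
intros Hg e He.
(* The radius [2 * d] leaves room for [w], since [|w - u| <= |w - z| + |z - u|] and each summand is
   below the local radius. *)
destruct (lebesgue_number_disk r
  (fun u d => forall w, Cmod (w - u) < 2 * d -> Cmod (g w - g u) < e / 2)%R) as [d [Hd H]].
{ intros u Hu; assert (He2 : (0 < e / 2)%R) by lra.
  destruct (proj1 (Ccontinuous_Cmod_iff g u) (Hg u Hu) _ He2) as [d [Hd H]].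
  exists (d / 2)%R; split; [lra|]; intros w Hw; apply H; lra. }
exists d; split; [exact Hd|]; intros z w Hz Hw.
destruct (H z Hz) as [u [q [Hu [Hq [H1 H2]]]]].
replace (g w - g z) with ((g w - g u) + - (g z - g u)) by ring.
eapply Rle_lt_trans; [apply Cmod_triangle|]; rewrite Cmod_opp.
assert (A := Cmod_triangle (w - z) (z - u)).
replace (w - z + (z - u)) with (w - u) in A by ring.
assert (Cmod (g w - g u) < e / 2)%R by (apply Hq; lra).
assert (Cmod (g z - g u) < e / 2)%R by (apply Hq; generalize (Cmod_ge_0 (z - u)); lra).
lra.
Qed.

(** * Moments: differentiation under the integral and integration by parts *)

Definition moment (n : nat) (g : C -> C) (z : C) : C :=
  RInt (V := C_R_CompleteNormedModule) (fun t : R => RtoC (t ^ n) * g (t * z)) 0 1.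

Lemma unit_disk_scal (t : R) (z : C) :
  unit_disk z -> (0 <= t <= 1)%R -> unit_disk (t * z).
Proof.
unfold unit_disk; intros Hz Ht; rewrite Cmod_mult, Cmod_R, Rabs_pos_eq by lra.
generalize (Cmod_ge_0 z); nra.
Qed.

Lemma continuous_ray (g : C -> C) (z : C) (t : R) :
  Ccontinuous g (t * z) -> continuous (U := C_UniformSpace) (fun s : R => g (s * z)) t.
Proof.
intros Hg; apply (continuous_comp (V := C_UniformSpace) (fun s : R => s * z) g); [|exact Hg].
apply continuous_Cmult; [apply continuous_RtoC|apply continuous_const].
Qed.

Lemma continuous_moment_integrand (n : nat) (g : C -> C) (z : C) (t : R) :
  Ccontinuous g (t * z) ->
  continuous (U := C_UniformSpace) (fun s : R => RtoC (s ^ n) * g (s * z)) t.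
Proof.
intros Hg; apply continuous_Cmult; [|now apply continuous_ray].
apply (continuous_comp (fun s : R => (s ^ n)%R) RtoC); [|apply continuous_RtoC].
apply (ex_derive_continuous (V := R_NormedModule) (fun s : R => (s ^ n)%R)).
auto_derive; trivial.
Qed.

Lemma is_RInt_moment (n : nat) (g : C -> C) (z : C) :
  unit_disk z -> (forall u, unit_disk u -> Ccontinuous g u) ->
  is_CRInt (fun t : R => RtoC (t ^ n) * g (t * z)) 0 1 (moment n g z).
Proof.
intros Hz Hg.
apply (RInt_correct (V := C_R_CompleteNormedModule)).
apply (ex_RInt_continuous (V := C_R_CompleteNormedModule)).
rewrite Rmin_left, Rmax_right by lra; intros t Ht.
apply continuous_moment_integrand, Hg, unit_disk_scal; assumption.
Qed.

(** The integral is taken in [C] as a real module, so a complex factor has to be pulled out through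
    the two components. *)
Lemma is_CRInt_Cmult (k : C) (f : R -> C) (a b : R) (l : C) :
  is_CRInt f a b l -> is_CRInt (fun t => k * f t) a b (k * l).
Proof.
intros H.
pose proof (is_RInt_fct_extend_fst (U := R_NormedModule) (V := R_NormedModule) f a b l H) as Hr.
pose proof (is_RInt_fct_extend_snd (U := R_NormedModule) (V := R_NormedModule) f a b l H) as Hi.
apply (is_RInt_fct_extend_pair (U := R_NormedModule) (V := R_NormedModule)).
- exact (is_RInt_minus (V := R_NormedModule) _ _ a b _ _
    (is_RInt_scal (V := R_NormedModule) _ a b (Re k) _ Hr)
    (is_RInt_scal (V := R_NormedModule) _ a b (Im k) _ Hi)).
- exact (is_RInt_plus (V := R_NormedModule) _ _ a b _ _
    (is_RInt_scal (V := R_NormedModule) _ a b (Re k) _ Hi)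
    (is_RInt_scal (V := R_NormedModule) _ a b (Im k) _ Hr)).
Qed.

Lemma norm_C_R (x : C) : norm (V := C_R_NormedModule) x = Cmod x.
Proof. symmetry; exact (Cmod_norm x). Qed.

(** The chain rule in [t * z] produces the additional factor [t]. Uniform continuity of [dg] and
    [mean_value_C] bound the first-order error of the integrand by [e * |w - z|] for all [t] in
    [[0, 1]] at once, and the bound survives integration. *)
Lemma is_Cderive_moment (n : nat) (g dg : C -> C) (z : C) :
  (forall u, unit_disk u -> is_Cderive g u (dg u)) ->
  (forall u, unit_disk u -> Ccontinuous dg u) ->
  unit_disk z ->
  is_Cderive (moment n g) z (moment (S n) dg z).
Proof.
intros Hg Hdg Hz.
assert (Cg : forall u, unit_disk u -> Ccontinuous g u)
  by (intros u Hu; apply is_Cderive_continuous with (dg u); auto).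
apply is_Cderive_Cmod_iff; intros e He.
destruct (uniform_continuity_disk dg (Cmod z)) with (e := e) as [d [Hd H]]; [|exact He|].
{ intros u Hu; apply Hdg; unfold unit_disk in *; lra. }
(* The second bound keeps the whole segment from [z] to [w] in the unit disk. *)
exists (Rmin d (1 - Cmod z)); split; [apply Rmin_pos; unfold unit_disk in Hz; lra|].
intros w Hw.
assert (Hw1 : (Cmod (w - z) < d)%R) by (eapply Rlt_le_trans; [exact Hw|apply Rmin_l]).
assert (Hw2 : (Cmod (w - z) < 1 - Cmod z)%R) by (eapply Rlt_le_trans; [exact Hw|apply Rmin_r]).
assert (Hseg : forall s : R, (0 <= s <= 1)%R -> unit_disk (z + s * (w - z))).
{ intros s Hs; unfold unit_disk.
  eapply Rle_lt_trans; [apply Cmod_triangle|].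
  rewrite Cmod_mult, Cmod_R, Rabs_pos_eq by lra.
  generalize (Cmod_ge_0 (w - z)); nra. }
assert (Hwd : unit_disk w).
{ replace w with (z + 1%R * (w - z)) by ring; apply Hseg; lra. }
pose proof (is_RInt_minus (V := C_R_NormedModule) _ _ 0 1 _ _
  (is_RInt_minus (V := C_R_NormedModule) _ _ 0 1 _ _
    (is_RInt_moment n g w Hwd Cg) (is_RInt_moment n g z Hz Cg))
  (is_CRInt_Cmult (w - z) _ 0 1 _ (is_RInt_moment (S n) dg z Hz Hdg))) as HI.
replace (e * Cmod (w - z))%R with ((1 - 0) * (e * Cmod (w - z)))%R by ring.
rewrite <- norm_C_R.
refine (norm_RInt_le_const (V := C_R_NormedModule) _ 0 1 _ _ _ _ HI); [lra|].
intros t Ht; rewrite norm_C_R.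
change (Cmod (RtoC (t ^ n) * g (RtoC t * w)%C - RtoC (t ^ n) * g (RtoC t * z)%C
  - (w - z) * (RtoC (t ^ S n) * dg (RtoC t * z)%C)) <= e * Cmod (w - z))%R.
replace (RtoC (t ^ n) * g (RtoC t * w) - RtoC (t ^ n) * g (RtoC t * z)
  - (w - z) * (RtoC (t ^ S n) * dg (RtoC t * z)))
  with (RtoC (t ^ n) * (g (RtoC t * z + RtoC t * (w - z)) - g (RtoC t * z)
         - RtoC t * (w - z) * dg (RtoC t * z)))
  by (replace (RtoC t * z + RtoC t * (w - z)) with (RtoC t * w) by ring;
      simpl pow; rewrite RtoC_mult; ring).
assert (Hpt : forall s : R, RtoC t * z + s * (RtoC t * (w - z)) = t * (z + s * (w - z)))
  by (intros s; ring).
assert (B : (Cmod (g (RtoC t * z + RtoC t * (w - z))%C - g (RtoC t * z)%C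
         - RtoC t * (w - z) * dg (RtoC t * z)%C) <= e * Cmod (RtoC t * (w - z)))%R).
{ apply (mean_value_C g dg).
  - intros s Hs; rewrite Hpt; apply Hg, unit_disk_scal; [apply Hseg; lra|exact Ht].
  - intros s Hs; rewrite Hpt; apply Cg, unit_disk_scal; [apply Hseg; lra|exact Ht].
  - intros s Hs; rewrite Hpt; apply Rlt_le, H.
    + rewrite Cmod_mult, Cmod_R, Rabs_pos_eq by lra.
      generalize (Cmod_ge_0 z); nra.
    + replace (t * (z + s * (w - z)) - t * z) with (RtoC (t * s) * (w - z))
        by (rewrite RtoC_mult; ring).
      rewrite Cmod_mult, Cmod_R, Rabs_pos_eq by nra.
      assert (t * s <= 1)%R by nra.
      generalize (Cmod_ge_0 (w - z)); nra. }
rewrite Cmod_mult in B |- *; rewrite Cmod_R in B |- *.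
rewrite Rabs_pos_eq in B by lra.
rewrite Rabs_pos_eq by (apply pow_le; lra).
assert (P1 : (t ^ n <= 1)%R).
{ rewrite <- (pow1 n); apply pow_incr; exact Ht. }
assert (P0 : (0 <= t ^ n)%R) by (apply pow_le; lra).
generalize (Cmod_ge_0 (w - z)); intros P2.
assert (A := Cmod_ge_0 (g (RtoC t * z + RtoC t * (w - z)) - g (RtoC t * z)
         - RtoC t * (w - z) * dg (RtoC t * z))).
assert (e * (t * Cmod (w - z)) <= e * Cmod (w - z))%R by (apply Rmult_le_compat_l; nra).
nra.
Qed.

Lemma is_derive_pow_mult (n : nat) (u : R -> R) (t du : R) :
  is_derive u t du ->
  is_derive (fun s : R => s ^ S n * u s)%R t
    (((1 + INR n) * (t ^ n * u t) + t ^ S n * du)%R).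
Proof.
intros Hu.
replace ((1 + INR n) * (t ^ n * u t) + t ^ S n * du)%R
  with (INR (S n) * 1 * t ^ n * u t + t ^ S n * du)%R by (rewrite S_INR; ring).
apply (is_derive_mult (fun s : R => (s ^ S n)%R) u); [|exact Hu|exact Rmult_comm].
apply (is_derive_pow (fun s : R => s) (S n)), (is_derive_id (K := R_AbsRing)).
Qed.

(** The derivative of [t^(n+1) g(t z)] in [t] is [df]; its integral is the boundary value [g z] at
    [t = 1], the one at [t = 0] being zero because of the power [n + 1]. *)
Lemma moment_by_parts (n : nat) (g dg : C -> C) (z : C) :
  (forall u, unit_disk u -> is_Cderive g u (dg u)) ->
  (forall u, unit_disk u -> Ccontinuous dg u) ->
  unit_disk z ->
  z * moment (S n) dg z = g z - (1 + RtoC (INR n)) * moment n g z.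
Proof.
intros Hg Hdg Hz.
assert (Cg : forall u, unit_disk u -> Ccontinuous g u)
  by (intros u Hu; apply is_Cderive_continuous with (dg u); auto).
set (df := fun t : R => (1 + RtoC (INR n)) * (RtoC (t ^ n) * g (t * z))
   + z * (RtoC (t ^ S n) * dg (t * z))).
pose proof (is_RInt_plus (V := C_R_NormedModule) _ _ 0 1 _ _
  (is_CRInt_Cmult (1 + RtoC (INR n)) _ 0 1 _ (is_RInt_moment n g z Hz Cg))
  (is_CRInt_Cmult z _ 0 1 _ (is_RInt_moment (S n) dg z Hz Hdg))) as H1.
change (is_CRInt df 0 1 ((1 + RtoC (INR n)) * moment n g z + z * moment (S n) dg z)) in H1.
assert (Cdf : forall t : R, (0 <= t <= 1)%R -> continuous (U := C_UniformSpace) df t).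
{ intros t Ht; apply continuous_Cplus; (apply continuous_Cmult; [apply continuous_const|]);
    apply continuous_moment_integrand; [apply Cg|apply Hdg]; now apply unit_disk_scal. }
assert (H2 : is_CRInt df 0 1 (g z)).
{ assert (Hpath : forall t : R, (0 <= t <= 1)%R -> is_Cderive g (0 + t * z) (dg (t * z))).
  { intros t Ht; rewrite Cplus_0_l; now apply Hg, unit_disk_scal. }
  assert (E : g z = (1 ^ S n * Re (g (0 + 1%R * z)%C) - 0 ^ S n * Re (g (0 + 0%R * z)%C),
                     1 ^ S n * Im (g (0 + 1%R * z)%C) - 0 ^ S n * Im (g (0 + 0%R * z)%C))%R).
  { replace (0 + 1%R * z) with z by ring.
    rewrite pow1; simpl pow; rewrite (surjective_pairing (g z)) at 1.
    unfold Re, Im; f_equal; ring. }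
  rewrite E.
  apply (is_RInt_fct_extend_pair (U := R_NormedModule) (V := R_NormedModule)).
  - apply (is_RInt_derive (V := R_CompleteNormedModule)
      (fun t : R => (t ^ S n * Re (g (0 + RtoC t * z)%C))%R));
      rewrite Rmin_left, Rmax_right by lra; intros t Ht.
    + refine (eq_ind _ (is_derive (K := R_AbsRing) (V := R_NormedModule) _ t)
        (is_derive_pow_mult n (fun t : R => Re (g (0 + RtoC t * z)%C)) t _
          (is_derive_Re_path g 0 z _ t (Hpath t Ht))) _ _).
      rewrite Cplus_0_l; unfold df, Re; simpl; ring.
    + apply (continuous_Re df), Cdf, Ht.
  - apply (is_RInt_derive (V := R_CompleteNormedModule)
      (fun t : R => (t ^ S n * Im (g (0 + RtoC t * z)%C))%R));
      rewrite Rmin_left, Rmax_right by lra; intros t Ht.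
    + refine (eq_ind _ (is_derive (K := R_AbsRing) (V := R_NormedModule) _ t)
        (is_derive_pow_mult n (fun t : R => Im (g (0 + RtoC t * z)%C)) t _
          (is_derive_Im_path g 0 z _ t (Hpath t Ht))) _ _).
      rewrite Cplus_0_l; unfold df, Im; simpl; ring.
    + apply (continuous_Im df), Cdf, Ht. }
pose proof (is_RInt_unique (V := C_R_CompleteNormedModule) _ _ _ _ H1) as E1.
pose proof (is_RInt_unique (V := C_R_CompleteNormedModule) _ _ _ _ H2) as E2.
rewrite E2 in E1; rewrite E1; ring.
Qed.

(** * First-order comparison at a point of first failure *)

(** Let [r] be the supremum of the radii of open disks on which [P] holds. If [P] also held on the
    circle [|u| = r], a Lebesgue number for the closed disk would enlarge the radius beyond [r]. *)
Lemma first_failure_disk (P : C -> Prop) (z1 : C) :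
  (forall u, unit_disk u -> P u -> locally (T := C_UniformSpace) u P) ->
  unit_disk z1 -> ~ P z1 ->
  exists z0, unit_disk z0 /\ ~ P z0 /\ forall u, (Cmod u < Cmod z0)%R -> P u.
Proof.
intros Hop Hz1 N1.
set (E := fun s : R => forall u, (Cmod u < s)%R -> P u).
assert (Eb : forall s, E s -> (s <= Cmod z1)%R).
{ intros s Hs; apply Rnot_lt_le; intros L; apply N1, (Hs z1 L). }
destruct (completeness E) as [r [Hub Hlub]].
{ exists (Cmod z1); exact Eb. }
{ exists 0%R; intros u Hu; generalize (Cmod_ge_0 u); lra. }
assert (Hr : (r < 1)%R) by (apply Rle_lt_trans with (Cmod z1); [now apply Hlub|exact Hz1]).
assert (Hin : forall u, (Cmod u < r)%R -> P u).
{ intros u Hu; apply NNPP; intros N.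
  apply (Rlt_not_le _ _ Hu), Hlub; intros s Hs.
  apply Rnot_lt_le; intros L; exact (N (Hs u L)). }
destruct (classic (exists z0, (Cmod z0 <= r)%R /\ ~ P z0)) as [[z0 [Hz0 N0]]|Hall].
{ exists z0; split; [unfold unit_disk; lra|split; [exact N0|]].
  intros u Hu; apply Hin; lra. }
exfalso.
assert (HP : forall u, (Cmod u <= r)%R -> P u).
{ intros u Hu; apply NNPP; intros N; apply Hall; exists u; auto. }
destruct (lebesgue_number_disk r (fun u d => forall w, (Cmod (w - u) < 2 * d)%R -> P w))
  as [d [Hd H]].
{ intros u Hu.
  assert (Hu' : unit_disk u) by (unfold unit_disk; lra).
  destruct (proj1 (locally_Cmod u P) (Hop u Hu' (HP u Hu))) as [d [Hd Hw]].
  exists (d / 2)%R; split; [lra|]; intros w L; apply Hw; lra. }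
assert (Hrd : E (r + d)%R).
{ intros w Hw; destruct (Rle_lt_dec (Cmod w) r) as [L|L]; [now apply HP|].
  destruct (Rlt_le_dec r 0) as [Rn|Rp].
  { exfalso; assert (E 0%R) by (intros u Hu; generalize (Cmod_ge_0 u); lra).
    specialize (Hub 0%R H0); lra. }
  (* The radial projection of [w] to the circle of radius [r], at distance [|w| - r < d]. *)
  set (z' := RtoC (r / Cmod w) * w).
  assert (Hz' : (Cmod z' <= r)%R).
  { unfold z'; rewrite Cmod_mult, Cmod_R, Rabs_pos_eq.
    - right; field; lra.
    - apply Rmult_le_pos; [exact Rp|apply Rlt_le, Rinv_0_lt_compat; lra]. }
  assert (Hdist : (Cmod (w - z') < d)%R).
  { replace (w - z') with (RtoC (1 - r / Cmod w) * w)
      by (unfold z'; rewrite RtoC_minus; ring).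
    rewrite Cmod_mult, Cmod_R, Rabs_pos_eq.
    - replace ((1 - r / Cmod w) * Cmod w)%R with (Cmod w - r)%R by (field; lra); lra.
    - apply Rmult_le_reg_r with (Cmod w); [lra|].
      replace ((1 - r / Cmod w) * Cmod w)%R with (Cmod w - r)%R by (field; lra); lra. }
  destruct (H z' Hz') as [u [e [Hu [Hq [H1 H2]]]]].
  apply Hq; replace (w - u) with ((w - z') + (z' - u)) by ring.
  eapply Rle_lt_trans; [apply Cmod_triangle|]; lra. }
specialize (Hub _ Hrd); lra.
Qed.

Lemma is_derive_Cmod2_path (g : C -> C) (a v l : C) (t : R) :
  is_Cderive g (a + t * v) l ->
  is_derive (fun s : R => Cmod (g (a + RtoC s * v)%C) ^ 2)%R t
    (2 * Re (Cconj (g (a + t * v)%C) * (v * l))%C)%R.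
Proof.
intros Hg.
pose proof (is_derive_Re_path _ _ _ _ _ Hg) as Hr.
pose proof (is_derive_Im_path _ _ _ _ _ Hg) as Hi.
apply (is_derive_ext (fun s : R =>
  Re (g (a + RtoC s * v)%C) ^ 2 + Im (g (a + RtoC s * v)%C) ^ 2)%R).
{ intros s; symmetry; apply Cmod2_alt. }
set (x := fun s : R => Re (g (a + s * v))) in *.
set (y := fun s : R => Im (g (a + s * v))) in *.
change (is_derive (fun s => (x s ^ 2 + y s ^ 2)%R) t (2 * Re (Cconj (g (a + t * v)%C) * (v * l))%C)%R).
assert (Ex : Re (g (a + t * v)) = x t) by reflexivity.
assert (Ey : Im (g (a + t * v)) = y t) by reflexivity.
rewrite (re_mult (Cconj _)), re_conj, im_conj, Ex, Ey; clearbody x y; clear Ex Ey.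
auto_derive.
- split; [eexists; exact Hr|split; [eexists; exact Hi|trivial]].
- replace (Derive (fun s : R => x s) t) with (Re (v * l))
    by (symmetry; apply is_derive_unique; exact Hr).
  replace (Derive (fun s : R => y s) t) with (Im (v * l))
    by (symmetry; apply is_derive_unique; exact Hi).
  ring.
Qed.

Lemma is_derive_right_nonneg (p : R -> R) (l d : R) :
  is_derive p 0 l -> (0 < d)%R -> (forall s, (0 < s < d)%R -> (0 < p s)%R) ->
  (0 <= p 0)%R /\ (p 0%R = 0%R -> (0 <= l)%R).
Proof.
intros Hp Hd Hpos; apply is_derive_Reals in Hp.
(* Differentiability bounds [p s] above by [p 0 + s * (l + e)] for small [s], so this line must stay
   positive. If [p 0 < 0], it fails near [s = 0]; if [p 0 = 0] and [l < 0], it fails for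
   [e = - l / 2]. *)
assert (K : forall e : R, (0 < e)%R -> exists b : R, (0 < b)%R /\
  forall s, (0 < s < b)%R -> (0 < p 0 + s * (l + e))%R).
{ intros e He; destruct (Hp e He) as [b Hb].
  exists (Rmin b d); split; [apply Rmin_pos; [apply cond_pos|exact Hd]|].
  intros s [Hs0 Hs].
  assert (s < b)%R by (eapply Rlt_le_trans; [exact Hs|apply Rmin_l]).
  assert (s < d)%R by (eapply Rlt_le_trans; [exact Hs|apply Rmin_r]).
  specialize (Hpos s (conj Hs0 H0)).
  assert (A : (Rabs ((p (0 + s) - p 0) / s - l) < e)%R)
    by (apply Hb; [lra|rewrite Rabs_pos_eq; lra]).
  rewrite Rplus_0_l in A; apply Rabs_def2 in A.
  assert (p s = p 0 + s * ((p s - p 0) / s))%R by (field; lra).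
  nra. }
split.
- apply Rnot_lt_le; intros N.
  destruct (K 1%R Rlt_0_1) as [b [Hb H]].
  set (m := (Rabs (l + 1) + 1)%R).
  assert (Hm : (0 < m)%R) by (unfold m; generalize (Rabs_pos (l + 1)); lra).
  set (s := Rmin (b / 2) (- p 0 / m)%R).
  assert (Hs : (0 < s)%R) by (apply Rmin_pos; [lra|apply Rdiv_lt_0_compat; lra]).
  assert (Hs1 : (s <= b / 2)%R) by apply Rmin_l.
  assert (Hs2 : (s <= - p 0 / m)%R) by apply Rmin_r.
  specialize (H s ltac:(lra)).
  assert (s * m <= - p 0)%R.
  { replace (- p 0)%R with (- p 0 / m * m)%R by (field; lra); nra. }
  assert (l + 1 <= m)%R by (unfold m; generalize (Rle_abs (l + 1)); lra).
  nra.
- intros Z; apply Rnot_lt_le; intros N.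
  destruct (K (- l / 2)%R ltac:(lra)) as [b [Hb H]].
  specialize (H (b / 2)%R ltac:(lra)); rewrite Z in H; nra.
Qed.

(* At a point of least modulus where the bound fails, [W = z H'/H] has modulus
   [M].  With [omega = k + W] the velocity [- z / omega] points into the
   smaller disk, and it moves the primitive [z^k H / k] of [z^(k-1) h] straight
   towards [0]; the defect [M^2 |H|^2 - |z H'|^2] decreases in this direction
   although it vanishes at [z] and is positive inside. *)
Lemma log_derivative_average_lt (M k : R) (h dh H dH : C -> C) :
  (0 < M < 1)%R -> (1 <= k)%R ->
  (forall u, unit_disk u -> is_Cderive h u (dh u)) ->
  (forall u, unit_disk u -> is_Cderive H u (dH u)) ->
  (forall u, unit_disk u -> u * dH u = k * (h u - H u)) ->
  (forall u, unit_disk u -> (Cmod (u * dh u) < M * Cmod (h u))%R) ->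
  H 0 <> 0 ->
  forall u, unit_disk u -> (Cmod (u * dH u) < M * Cmod (H u))%R.
Proof.
intros HM Hk Hh HH HE Hlt H0 z1 Hz1.
(* [G u] is [u * dH u] on the disk, in a form whose derivative needs only [dh] and [dH]. *)
set (G := fun u => k * (h u - H u)).
set (dG := fun u => k * (dh u - dH u)).
assert (HG : forall u, unit_disk u -> is_Cderive G u (dG u)).
{ intros u Hu; unfold G, dG.
  replace (k * (dh u - dH u)) with (0 * (h u - H u) + k * (dh u - dH u)) by ring.
  apply (is_Cderive_mult (fun _ => RtoC k) (fun w => h w - H w)); [apply is_Cderive_const|].
  apply is_Cderive_minus; auto. }
assert (CH : forall u, unit_disk u -> Ccontinuous H u)
  by (intros u Hu; apply is_Cderive_continuous with (dH u); auto).
assert (CG : forall u, unit_disk u -> Ccontinuous G u)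
  by (intros u Hu; apply is_Cderive_continuous with (dG u); auto).
rewrite HE by exact Hz1; fold (G z1).
apply NNPP; intros N1.
destruct (first_failure_disk (fun u => (Cmod (G u) < M * Cmod (H u))%R) z1)
  as [z [Hz [Nz Hin]]]; [|exact Hz1|exact N1|].
{ intros u Hu L; apply locally_Cmod.
  set (e := ((M * Cmod (H u) - Cmod (G u)) / 2)%R).
  assert (He : (0 < e)%R) by (unfold e; lra).
  destruct (proj1 (Ccontinuous_Cmod_iff H u) (CH u Hu) e He) as [d1 [Hd1 D1]].
  destruct (proj1 (Ccontinuous_Cmod_iff G u) (CG u Hu) e He) as [d2 [Hd2 D2]].
  exists (Rmin d1 d2); split; [now apply Rmin_pos|]; intros w Hw.
  assert (A1 := D1 w (Rlt_le_trans _ _ _ Hw (Rmin_l _ _))).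
  assert (A2 := D2 w (Rlt_le_trans _ _ _ Hw (Rmin_r _ _))).
  assert (B1 := Cmod_triangle (H w) (- (H w - H u))).
  replace (H w + - (H w - H u)) with (H u) in B1 by ring; rewrite Cmod_opp in B1.
  assert (B2 := Cmod_triangle (G u) (G w - G u)).
  replace (G u + (G w - G u)) with (G w) in B2 by ring.
  unfold e in *; nra. }
apply Rnot_lt_le in Nz.
assert (D0 : unit_disk 0) by (unfold unit_disk; rewrite Cmod_0; lra).
assert (Hz0 : z <> 0).
{ intros ->; unfold G in Nz; rewrite <- HE, Cmult_0_l, Cmod_0 in Nz by exact D0.
  apply Cmod_gt_0 in H0; nra. }
assert (Hzp : (0 < Cmod z)%R) by now apply Cmod_gt_0.
assert (Hray : forall s : R, (0 <= s < 1)%R -> (Cmod (G (s * z)%C) < M * Cmod (H (s * z)%C))%R).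
{ intros s Hs; apply Hin; rewrite Cmod_mult, Cmod_R, Rabs_pos_eq by lra; nra. }
(* [|s H(s z)|] is nondecreasing in [s] as long as [|z H'| <= |H|]. *)
assert (HHz : H z <> 0).
{ intros Z.
  set (F := fun w => w * H w).
  destruct (MVT_gen (fun s : R => (Cmod (F (0 + RtoC s * z)%C) ^ 2)%R) (1 / 2) 1
    (fun s : R => (2 * Re (Cconj (F (0 + RtoC s * z)%C) * (z * (H (s * z)%C + G (s * z)%C)))%C)%R))
    as [s [Hs E]].
  1,2: rewrite Rmin_left, Rmax_right by lra; intros s Hs.
  - apply is_derive_Cmod2_path; rewrite Cplus_0_l.
    assert (Ds : unit_disk (s * z)) by (apply unit_disk_scal; [exact Hz|lra]).
    replace (H (s * z) + G (s * z)) with (1 * H (s * z) + (s * z) * dH (s * z))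
      by (rewrite HE by exact Ds; unfold G; ring).
    apply (is_Cderive_mult (fun w => w) H); [apply is_Cderive_id|now apply HH].
  - apply continuity_pt_filterlim, (ex_derive_continuous (V := R_NormedModule)).
    assert (Ds : unit_disk (s * z)) by (apply unit_disk_scal; [exact Hz|lra]).
    eexists; apply is_derive_Cmod2_path; rewrite Cplus_0_l.
    apply (is_Cderive_mult (fun w => w) H); [apply is_Cderive_id|now apply HH].
  - rewrite Rmin_left, Rmax_right in Hs by lra.
    rewrite !Cplus_0_l in E.
    replace (1%R * z) with z in E by ring.
    unfold F at 1 in E; rewrite Z, Cmult_0_r, Cmod_0 in E.
    (* Before [z] the strict inequality excludes zeros of [H], so [|F|] is positive halfway; a
       nondecreasing [|F|] cannot then vanish at [z]. *)
    assert (P : (0 < Cmod (F ((1 / 2)%R * z)%C))%R).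
    { apply Cmod_gt_0; unfold F; apply Cmult_neq_0.
      - apply Cmult_neq_0; [|exact Hz0]; intros X; apply RtoC_inj in X; lra.
      - specialize (Hray (1 / 2)%R ltac:(lra)); intros X; rewrite X, Cmod_0 in Hray.
        generalize (Cmod_ge_0 (G ((1 / 2)%R * z))); lra. }
    assert (Q : (0 <= Re (Cconj (F (s * z)%C) * (z * (H (s * z)%C + G (s * z)%C))))%R).
    { unfold F; set (a := H (s * z)); set (b := G (s * z)).
      replace (Cconj (s * z * a) * (z * (a + b)))
        with (s * ((z * Cconj z) * (a * Cconj a + Cconj a * b)))
        by (rewrite !Cmult_conj; replace (Cconj s) with (RtoC s)
             by (unfold Cconj; simpl; rewrite Ropp_0; reflexivity); ring).
      rewrite <- !Cmod2_conj, re_scal_l, re_scal_l, re_plus, re_RtoC.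
      apply Rmult_le_pos; [lra|]; apply Rmult_le_pos; [apply pow2_ge_0|].
      assert (L : (- (Cmod a * Cmod b) <= Re (Cconj a * b))%R).
      { assert (A := re_le_Cmod (Cconj a * b)); rewrite Cmod_mult, Cmod_conj in A.
        apply Rabs_le_between in A; lra. }
      assert (Lab : (Cmod a * Cmod b <= Cmod a ^ 2)%R).
      { destruct (Rle_lt_or_eq_dec s 1) as [s1|s1]; [lra| |].
        - specialize (Hray s ltac:(lra)); fold a b in Hray.
          generalize (Cmod_ge_0 a) (Cmod_ge_0 b); nra.
        - unfold a; rewrite s1; replace (1%R * z) with z by ring.
          rewrite Z, Cmod_0; lra. }
      lra. }
    apply (pow_lt _ 2) in P.
    rewrite pow_i in E by lia; lra. }
set (a := H z) in *; set (b := G z) in *.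
assert (Hder : forall v : C, is_derive
  (fun s : R => M ^ 2 * Cmod (H (z + RtoC s * v)%C) ^ 2 - Cmod (G (z + RtoC s * v)%C) ^ 2)%R 0
  (M ^ 2 * (2 * Re (Cconj a * (v * dH z))%C) - 2 * Re (Cconj b * (v * dG z))%C)%R).
{ intros v; assert (Ez : z + 0%R * v = z) by ring.
  apply (is_derive_minus (V := R_NormedModule)).
  - apply (is_derive_scal (fun s : R => (Cmod (H (z + RtoC s * v)%C) ^ 2)%R)).
    pose proof (is_derive_Cmod2_path H z v (dH z) 0) as A; rewrite Ez in A.
    apply A; auto.
  - pose proof (is_derive_Cmod2_path G z v (dG z) 0) as A; rewrite Ez in A.
    apply A; auto. }
assert (Hpos : forall u, (Cmod u < Cmod z)%R -> (0 < M ^ 2 * Cmod (H u) ^ 2 - Cmod (G u) ^ 2)%R).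
{ intros u Hu; specialize (Hin u Hu); generalize (Cmod_ge_0 (G u)) (Cmod_ge_0 (H u)); nra. }
assert (Ez0 : forall v : C, z + 0%R * v = z) by (intros v; ring).
(* Moving radially inwards, the defect at [z] is a limit of positive values, hence nonnegative; [Nz]
   is the reverse inequality. *)
assert (Eab : (Cmod b = M * Cmod a)%R).
{ destruct (is_derive_right_nonneg _ _ 1 (Hder (- z))) as [A _]; [lra| |].
  - intros s Hs; apply Hpos.
    replace (z + s * - z) with (RtoC (1 - s) * z) by (rewrite RtoC_minus; ring).
    rewrite Cmod_mult, Cmod_R, Rabs_pos_eq by lra; nra.
  - rewrite Ez0 in A; fold a b in A.
    assert (0 <= M * Cmod a)%R by (apply Rmult_le_pos; [lra|apply Cmod_ge_0]).
    apply Rle_antisym; [|exact Nz].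
    apply Rsqr_incr_0_var; [unfold Rsqr; lra|assumption]. }
assert (Ha : (0 < Cmod a)%R) by now apply Cmod_gt_0.
set (W := b / a).
assert (EW : b = W * a) by (unfold W; field; exact HHz).
assert (HW : (Cmod W = M)%R).
{ unfold W; rewrite Cmod_div by exact HHz; rewrite Eab; field; lra. }
set (omega := k + W).
assert (Hom : (0 < Re omega)%R).
{ unfold omega; rewrite re_plus, re_RtoC.
  assert (A := re_le_Cmod W); rewrite HW in A; apply Rabs_le_between in A; lra. }
assert (Hom0 : omega <> 0) by (intros X; rewrite X in Hom; simpl in Hom; lra).
assert (Hop : (0 < Cmod omega)%R) by now apply Cmod_gt_0.
(* The moving point is [z * (omega - s) / omega], and [|omega - s| < |omega|] holds exactly for
   [0 < s < 2 * Re omega]. *)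
destruct (is_derive_right_nonneg _ _ (2 * Re omega) (Hder (- z / omega))) as [_ A]; [lra| |].
{ intros s Hs; apply Hpos.
  replace (z + s * (- z / omega)) with (z * ((omega - s) / omega)) by (field; exact Hom0).
  rewrite Cmod_mult, Cmod_div by exact Hom0.
  assert (L : (Cmod (omega - s) < Cmod omega)%R).
  { apply Rsqr_incrst_0; try apply Cmod_ge_0; unfold Rsqr.
    assert (A1 := Cmod2_alt (omega - s)); assert (A2 := Cmod2_alt omega).
    replace (Re (omega - s)) with (Re omega - s)%R in A1 by reflexivity.
    replace (Im (omega - s)) with (Im omega) in A1 by (unfold Im; simpl; ring).
    nra. }
  rewrite <- (Rmult_1_r (Cmod z)) at 2; apply Rmult_lt_compat_l; [exact Hzp|].
  apply Rmult_lt_reg_r with (Cmod omega); [exact Hop|].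
  unfold Rdiv; rewrite Rmult_assoc, Rinv_l; lra. }
rewrite Ez0 in A; fold a b in A; rewrite Eab in A.
specialize (A ltac:(ring)).
(* As [k * h z = omega * a], this is [a] times [z h'/h], that is [(q - 1) H] at [z], written without
   dividing by [h z]. *)
set (y := k * (z * dh z) / omega).
assert (Eh : k * h z = omega * a).
{ unfold omega; replace ((k + W) * a) with (k * a + b) by (rewrite EW; ring).
  unfold b, G; fold a; ring. }
assert (Hy : (Cmod y < M * Cmod a)%R).
{ assert (Eh' := f_equal Cmod Eh); rewrite !Cmod_mult, Cmod_R, Rabs_pos_eq in Eh' by lra.
  specialize (Hlt z Hz).
  unfold y; rewrite Cmod_div, (Cmod_mult k), Cmod_R, Rabs_pos_eq by (exact Hom0 || lra).
  apply Rmult_lt_reg_r with (Cmod omega); [exact Hop|].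
  unfold Rdiv; rewrite Rmult_assoc, Rinv_l by lra; nra. }
assert (E1 : - z / omega * dH z = - b / omega).
{ replace (- z / omega * dH z) with (- (z * dH z) / omega) by (field; exact Hom0).
  rewrite HE by exact Hz; reflexivity. }
assert (E2 : - z / omega * dG z = k * b / omega - y).
{ unfold dG, y.
  replace (- z / omega * (k * (dh z - dH z)))
    with (k * (z * dH z) / omega - k * (z * dh z) / omega) by (field; exact Hom0).
  rewrite HE by exact Hz; reflexivity. }
rewrite E1, E2 in A.
assert (EN : RtoC (M ^ 2) * (Cconj a * a) = Cconj b * b).
{ rewrite (Cmult_comm (Cconj a)), (Cmult_comm (Cconj b)), <- !Cmod2_conj, <- RtoC_mult.
  rewrite Eab; f_equal; ring. }
(* By [EN] the terms over [omega] add up to [- |b|^2 (W + k) / omega = - |b|^2]. A nonnegative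
   derivative then gives [|b|^2 <= |b| |y|], against [|y| < M |a| = |b|]. *)
assert (ER : (M ^ 2 * Re (Cconj a * (- b / omega))%C - Re (Cconj b * (k * b / omega - y))%C
  = Re (Cconj b * y)%C - Cmod b ^ 2)%R).
{ rewrite <- re_scal_l, <- (re_RtoC (Cmod b ^ 2)), Cmod2_conj.
  unfold Rminus; rewrite <- !re_opp, <- !re_plus; f_equal.
  replace (RtoC (M ^ 2) * (Cconj a * (- b / omega)))
    with (- (RtoC (M ^ 2) * (Cconj a * a)) * W / omega)
    by (rewrite EW; field; exact Hom0).
  rewrite EN; unfold omega; field; exact Hom0. }
assert (L : (Re (Cconj b * y) <= Cmod b * Cmod y)%R).
{ rewrite <- (Cmod_conj b), <- Cmod_mult.
  eapply Rle_trans; [apply Rle_abs|apply re_le_Cmod]. }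
rewrite Eab in L, ER.
assert (0 < M * Cmod a)%R by nra.
nra.
Qed.

(** * Dependence on the values in the disk only *)

Lemma locally_unit_disk (z : C) :
  unit_disk z -> locally (T := C_UniformSpace) z unit_disk.
Proof.
unfold unit_disk; intros Hz; apply locally_Cmod; exists (1 - Cmod z)%R; split; [lra|].
intros w Hw; replace w with ((w - z) + z) by ring.
eapply Rle_lt_trans; [apply Cmod_triangle|]; lra.
Qed.

Lemma locally_neq (z a : C) : z <> a -> locally (T := C_UniformSpace) z (fun w => w <> a).
Proof.
intros Hz; generalize (locally_neq_0 (fun w => w - a) z
  (continuous_Cminus _ _ _ (continuous_id z) (continuous_const a z)) (Cminus_eq_contra _ _ Hz)).
apply filter_imp; intros w Hw ->; apply Hw; ring.
Qed.

Lemma is_Cderive_ext_loc (f g : C -> C) (z l : C) :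
  locally (T := C_UniformSpace) z (fun w => f w = g w) ->
  is_Cderive f z l -> is_Cderive g z l.
Proof.
intros E; apply (is_derive_ext_loc (K := C_AbsRing) (V := C_NormedModule)).
apply (locally_C z), E.
Qed.

Lemma is_Cderive_ext_disk (f g : C -> C) (z l : C) :
  (forall u, unit_disk u -> f u = g u) -> unit_disk z ->
  is_Cderive f z l -> is_Cderive g z l.
Proof.
intros E Hz; apply is_Cderive_ext_loc.
generalize (locally_unit_disk z Hz); apply filter_imp, E.
Qed.

Lemma C_derive_ext_disk (f g : C -> C) (z : C) :
  (forall u, unit_disk u -> f u = g u) -> unit_disk z ->
  ex_derive (K := C_AbsRing) (V := C_NormedModule) f z -> C_derive g z = C_derive f z.
Proof.
intros E Hz Hf; apply is_C_derive_unique.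
apply (is_Cderive_ext_disk f); [exact E|exact Hz|].
now apply C_derive_correct.
Qed.

(** Functions are total on [C]; this passes from [z * H z] to the transform, and from the transform
    to any member of its image. *)
Lemma S_class_ext (M : R) (f g : C -> C) :
  (forall z, unit_disk z -> g z = f z) -> S_class M f -> S_class M g.
Proof.
intros E [[Hf [Hf0 Hf1]] [Hn [Hq Hb]]].
assert (E' : forall z, unit_disk z -> f z = g z) by (intros z Hz; symmetry; auto).
assert (D0 : unit_disk 0) by (unfold unit_disk; rewrite Cmod_0; lra).
assert (EQ : forall z, unit_disk z -> log_quotient f z = log_quotient g z).
{ intros z Hz; unfold log_quotient.
  rewrite (E z Hz), (C_derive_ext_disk f g z E' Hz (Hf z Hz)); reflexivity. }
split; [split; [|split]|split; [|split]].
- intros z Hz; destruct (Hf z Hz) as [l Hl]; exists l.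
  exact (is_Cderive_ext_disk f g z l E' Hz Hl).
- now rewrite (E 0 D0).
- rewrite (C_derive_ext_disk f g 0 E' D0 (Hf 0 D0)); exact Hf1.
- intros z Hz; rewrite (E z Hz); now apply Hn.
- intros z Hz; destruct (Hq z Hz) as [l Hl]; exists l.
  exact (is_Cderive_ext_disk _ _ z l EQ Hz Hl).
- intros z Hz; rewrite <- (EQ z Hz); now apply Hb.
Qed.

(** * Removing the singularities at the origin *)

(** This makes [h = f z / z] differentiable at [0] without a second derivative of [f]: the mean
    value inequality, with continuity alone at the endpoint [0], transfers the limit of [dh] to the
    difference quotient. *)
Lemma is_Cderive_of_derivative_limit (h dh : C -> C) (d : R) :
  (0 < d)%R ->
  (forall u : C, u <> 0 -> (Cmod u < d)%R -> is_Cderive h u (dh u)) ->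
  Ccontinuous h (RtoC 0) -> Ccontinuous dh (RtoC 0) -> is_Cderive h (RtoC 0) (dh 0).
Proof.
intros Hd Hh Ch Cdh; apply is_Cderive_Cmod_iff; intros e He.
destruct (proj1 (Ccontinuous_Cmod_iff dh 0) Cdh e He) as [b [Hb H]].
exists (Rmin b d); split; [now apply Rmin_pos|]; intros w Hw.
replace (w - 0) with w in * by ring.
assert (Hwb := Rlt_le_trans _ _ _ Hw (Rmin_l _ _)).
assert (Hwd := Rlt_le_trans _ _ _ Hw (Rmin_r _ _)).
destruct (Ceq_dec w 0) as [->|Hw0].
{ replace (h 0 - h 0 - 0 * dh 0) with (RtoC 0) by ring; rewrite Cmod_0; lra. }
assert (Hp : (0 < Cmod w)%R) by now apply Cmod_gt_0.
assert (Hc : forall s : R, (0 <= s <= 1)%R -> (Cmod (s * w) <= Cmod w)%R).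
{ intros s Hs; rewrite Cmod_mult, Cmod_R, Rabs_pos_eq by lra; nra. }
assert (Hder : forall s : R, (0 < s <= 1)%R -> is_Cderive h (s * w) (dh (s * w))).
{ intros s Hs; apply Hh.
  - apply Cmult_neq_0; [|exact Hw0]; intros X; apply RtoC_inj in X; lra.
  - specialize (Hc s ltac:(lra)); lra. }
pose proof (mean_value_C h dh 0 w (dh 0) e) as A; rewrite Cplus_0_l in A; apply A.
- intros s Hs; rewrite Cplus_0_l; apply Hder; lra.
- intros s Hs; rewrite Cplus_0_l.
  destruct (Req_dec s 0) as [->|Hs0].
  + replace (0%R * w) with (RtoC 0) by ring; exact Ch.
  + apply is_Cderive_continuous with (dh (s * w)), Hder; lra.
- intros s Hs; rewrite Cplus_0_l; apply Rlt_le, H.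
  replace (s * w - 0) with (s * w) by ring; specialize (Hc s Hs); lra.
Qed.

(* [h = f z / z] and [p = (log_quotient f - 1) / z] with their singularities removed. *)
Lemma S_class_factor (M : R) (f : C -> C) :
  S_class M f -> exists h p : C -> C,
    (forall z, f z = z * h z) /\ h 0 = 1 /\
    (forall z, log_quotient f z = 1 + z * p z) /\
    (forall z, unit_disk z -> Ccontinuous p z) /\
    (forall z, unit_disk z -> is_Cderive h z (h z * p z)).
Proof.
intros [[Hf [Hf0 Hf1]] [Hn [Hq Hb]]].
assert (D0 : unit_disk 0) by (unfold unit_disk; rewrite Cmod_0; lra).
pose proof (C_derive_correct f 0 0 (Hf 0 D0)) as Df; rewrite Hf1 in Df.
destruct (Hq 0 D0) as [L Dq].
destruct (Cderive_caratheodory f 0 1 Df) as [h [Ch [h0 Eh]]].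
destruct (Cderive_caratheodory _ 0 L Dq) as [p [Cp [p0 Ep]]].
assert (Eh' : forall z, f z = z * h z).
{ intros z; specialize (Eh z); rewrite Hf0 in Eh.
  replace (f z) with (f z - 0) by ring; rewrite Eh; ring. }
assert (Ep' : forall z, log_quotient f z = 1 + z * p z).
{ intros z; specialize (Ep z); unfold log_quotient at 2 in Ep.
  destruct (Ceq_dec 0 0) as [_|X]; [|congruence].
  replace (log_quotient f z) with (1 + (log_quotient f z - 1)) by ring; rewrite Ep; ring. }
assert (Cp' : forall z, unit_disk z -> Ccontinuous p z).
{ intros z Hz; destruct (Ceq_dec z 0) as [->|Z]; [exact Cp|].
  apply (continuous_ext_loc (U := C_UniformSpace) (T := C_UniformSpace) p
    (fun w => (log_quotient f w - 1) / w) z).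
  - generalize (locally_neq z 0 Z); apply filter_imp; intros w Hw.
    rewrite Ep'; change ((1 + w * p w - 1) / w = p w); field; exact Hw.
  - apply continuous_Cdiv; [exact Z| |apply continuous_id].
    apply continuous_Cminus; [|apply continuous_const].
    destruct (Hq z Hz) as [l Hl]; exact (is_Cderive_continuous _ z l Hl). }
assert (Dh : forall z : C, z <> 0 -> unit_disk z -> is_Cderive h z (h z * p z)).
{ intros z Z Hz.
  apply (is_Cderive_ext_loc (fun w => f w * / w)).
  - generalize (locally_neq z 0 Z); apply filter_imp; intros w Hw.
    rewrite Eh'; field; exact Hw.
  - assert (Fz : f z <> 0) by now apply Hn.
    assert (Ed : C_derive f z = (1 + z * p z) * h z).
    { rewrite <- Ep'; unfold log_quotient; destruct (Ceq_dec z 0) as [X|_]; [congruence|].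
      assert (Hz0 : h z <> 0) by (intros X; apply Fz; rewrite Eh', X; ring).
      rewrite Eh'; field; split; assumption. }
    (* The quotient rule for [f z / z], with [f' = (1 + z p) h] read off from [log_quotient]. *)
    replace (h z * p z) with (C_derive f z * / z + f z * (- (1) / (z * z)))
      by (rewrite Ed, Eh'; field; exact Z).
    apply is_Cderive_mult; [now apply C_derive_correct, Hf|].
    apply (is_Cderive_inv (fun w => w)); [exact Z|apply is_Cderive_id]. }
exists h, p; do 4 (split; [assumption|]).
intros z Hz; destruct (Ceq_dec z 0) as [->|Z]; [|now apply Dh].
apply (is_Cderive_of_derivative_limit h (fun u => h u * p u) 1); [lra| |exact Ch|].
- intros u U Hu; now apply Dh.
- now apply continuous_Cmult.
Qed.

(** * The Bernardi transform *)

Lemma bernardi_moment (c : nat) (f h : C -> C) (z : C) :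
  (forall u, f u = u * h u) -> (forall u, unit_disk u -> Ccontinuous h u) ->
  unit_disk z -> bernardi c f z = z * ((1 + RtoC (INR c)) * moment c h z).
Proof.
intros Ef Hh Hz; unfold bernardi; destruct (Ceq_dec z 0) as [->|Z]; [ring|].
assert (Zc : z ^ c <> 0) by now apply Cpow_nz.
unfold segment_integral.
rewrite (RInt_ext (V := C_R_CompleteNormedModule) _ (fun t : R => z ^ c * (RtoC (t ^ c) * h (t * z)))).
- rewrite (is_RInt_unique (V := C_R_CompleteNormedModule) _ _ _ _
    (is_CRInt_Cmult (z ^ c) _ 0 1 _ (is_RInt_moment c h z Hz Hh))).
  field; exact Zc.
(* The integrands are compared on the open interval only, so [t <> 0] and the inverse occurring for
   [c = 0] cancels. *)
- rewrite Rmin_left, Rmax_right by lra; intros t Ht.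
  assert (T : RtoC t <> 0) by (intros X; apply RtoC_inj in X; lra).
  rewrite Ef; destruct c as [|c]; unfold Cpow_pred.
  + change (/ (t * z) * (t * z * h (t * z)) = 1 * (1 * h (t * z))).
    field; split; assumption.
  + rewrite Cpow_mult_l, !Cpow_S, RtoC_pow, Cpow_S.
    match goal with |- ?x = ?y => change (@eq C x y) end; ring.
Qed.

Lemma bernardi_S_class (M : R) (f : C -> C) (c : nat) :
  (0 < M < 1)%R -> S_class M f -> S_class M (bernardi c f).
Proof.
intros HM Sf; destruct (S_class_factor M f Sf) as [h [p [Ef [h0 [Eq [Cp Dh]]]]]].
destruct Sf as [_ [Hn [_ Hb]]].
assert (D0 : unit_disk 0) by (unfold unit_disk; rewrite Cmod_0; lra).
set (dh := fun u => h u * p u).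
assert (Ch : forall u, unit_disk u -> Ccontinuous h u)
  by (intros u Hu; apply is_Cderive_continuous with (dh u), Dh, Hu).
assert (Cdh : forall u, unit_disk u -> Ccontinuous dh u)
  by (intros u Hu; apply continuous_Cmult; auto).
set (k := 1 + RtoC (INR c)).
assert (Ek : k = RtoC (1 + INR c)) by (unfold k; now rewrite RtoC_plus).
set (H := fun u => k * moment c h u).
set (dH := fun u => k * moment (S c) dh u).
assert (DH : forall u, unit_disk u -> is_Cderive H u (dH u)).
{ intros u Hu; unfold H, dH.
  replace (k * moment (S c) dh u) with (0 * moment c h u + k * moment (S c) dh u) by ring.
  apply (is_Cderive_mult (fun _ => k) (moment c h)); [apply is_Cderive_const|].
  now apply is_Cderive_moment. }
assert (EH : forall u, unit_disk u -> u * dH u = k * (h u - H u)).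
{ intros u Hu; unfold H, dH.
  replace (u * (k * moment (S c) dh u)) with (k * (u * moment (S c) dh u)) by ring.
  now rewrite (moment_by_parts c h dh u Dh Cdh Hu). }
assert (k0 : k <> 0).
{ rewrite Ek; intros X; apply RtoC_inj in X; generalize (pos_INR c); lra. }
assert (H00 : H 0 = 1).
(* At the origin, integration by parts reads [0 = h 0 - H 0]. *)
{ assert (A := moment_by_parts c h dh 0 Dh Cdh D0); rewrite h0, Cmult_0_l in A.
  unfold H; fold k in A.
  replace (k * moment c h 0) with (1 - (1 - k * moment c h 0)) by ring.
  rewrite <- A; ring. }
assert (hn : forall u, unit_disk u -> h u <> 0).
{ intros u Hu; destruct (Ceq_dec u 0) as [->|U]; [rewrite h0; exact C1_nz|].
  intros X; apply (Hn u Hu U); rewrite Ef, X; ring. }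
assert (Hlt : forall u, unit_disk u -> (Cmod (u * dH u) < M * Cmod (H u))%R).
{ apply (log_derivative_average_lt M (1 + INR c) h dh H dH); auto.
  - generalize (pos_INR c); lra.
  - intros u Hu; rewrite <- Ek; auto.
  - intros u Hu; unfold dh; replace (u * (h u * p u)) with ((u * p u) * h u) by ring.
    rewrite Cmod_mult; apply Rmult_lt_compat_r; [apply Cmod_gt_0; auto|].
    specialize (Hb u Hu); rewrite Eq in Hb.
    now replace (1 + u * p u - 1) with (u * p u) in Hb by ring.
  - rewrite H00; exact C1_nz. }
assert (Hnz : forall u, unit_disk u -> H u <> 0).
{ intros u Hu X; specialize (Hlt u Hu); rewrite X, Cmod_0 in Hlt.
  generalize (Cmod_ge_0 (u * dH u)); lra. }
set (B := fun u : C => u * H u).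
apply (S_class_ext M B).
{ intros z Hz; now apply bernardi_moment. }
assert (DB : forall u, unit_disk u -> is_Cderive B u (1 * H u + u * dH u)).
{ intros u Hu; apply (is_Cderive_mult (fun w => w) H); [apply is_Cderive_id|auto]. }
(* The left side is built from [h] and [H] alone, so it is differentiable, also at [0], where it
   equals [1]; thus [log_quotient B] is analytic without differentiating [B] twice. *)
assert (EB : forall u, unit_disk u ->
  1 + k * (h u - H u) * / H u = log_quotient B u).
{ intros u Hu; unfold log_quotient; rewrite <- (EH u Hu).
  destruct (Ceq_dec u 0) as [->|U]; [ring|].
  rewrite (is_C_derive_unique B _ _ (DB u Hu)); unfold B; field; split; auto. }
split; [split; [|split]|split; [|split]].
- intros z Hz; eexists; exact (DB z Hz).
- apply Cmult_0_l.
- rewrite (is_C_derive_unique B _ _ (DB 0 D0)), H00; ring.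
- intros z Hz Z; apply Cmult_neq_0; auto.
- intros z Hz; eexists.
  apply (is_Cderive_ext_disk _ _ z _ EB Hz).
  apply (is_derive_plus (K := C_AbsRing) (V := C_NormedModule) (fun _ => RtoC 1));
    [apply is_Cderive_const|].
  apply (is_Cderive_mult (fun w => k * (h w - H w)) (fun w => / H w)).
  + apply (is_Cderive_mult (fun _ => k) (fun w => h w - H w)); [apply is_Cderive_const|].
    apply is_Cderive_minus; auto.
  + apply is_Cderive_inv; auto.
- intros z Hz; rewrite <- (EB z Hz), <- (EH z Hz).
  replace (1 + z * dH z * / H z - 1) with (z * dH z / H z) by (field; auto).
  rewrite Cmod_div by auto.
  assert (0 < Cmod (H z))%R by (apply Cmod_gt_0; auto).
  apply Rmult_lt_reg_r with (Cmod (H z)); [assumption|].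
  unfold Rdiv; rewrite Rmult_assoc, Rinv_l by lra; rewrite Rmult_1_r; auto.
Qed.

Theorem lemma2p3 (M : R) (hM0 : (0 < M)%R) (hM1 : (M < 1)%R) :
  (forall (f : C -> C), S_class M f ->
     forall c : nat, S_class M (bernardi c f)) /\
  (forall (c : nat) (g : C -> C),
     bernardi_image c (S_class M) g -> S_class M g).
Proof.
assert (HB : forall f, S_class M f -> forall c, S_class M (bernardi c f))
  by (intros f Hf c; apply bernardi_S_class; [split|]; assumption).
split; [exact HB|].
intros c g [f [Hf Hg]]; apply (S_class_ext M (bernardi c f)); auto.
Qed.
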